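(* There exists a constant $\epsilon>0$ such that $\overline{\mathrm{AECR}}(\mathrm{DNF}) \ge \frac12+\epsilon$, i.e., for every discrete distribution $F$, \[ \liminf_{n\to\infty}\frac{\mathbb{E}[\mathrm{DNF}(I_n(F))]}{\mathbb{E}[\mathrm{OPT}(I_n(F))]}\ \ge\ \frac12+\epsilon . \]
   Context: Bin covering: a list $L=(a_1,\ldots,a_N)$ of item sizes in $[0,1]$ is given; a bin is a set of items and is covered if its total size is at least $1$. $\mathrm{OPT}(L)$ is the maximum number of pairwise disjoint sets of items of $L$ each of total size at least $1$. Dual Next-Fit ($\mathrm{DNF}$) processes the items in the given order, putting every item into a single current bin; as soon as the total size in the current bin is at least $1$, this bin is counted as covered and a new empty current bin is started. $\mathrm{DNF}(L)$ is the number of bins covered. A discrete distribution $F$ is given by a vector $(s_1,\ldots,s_m)$ of non-negative rational item sizes and a vector $(p_1,\ldots,p_m)$ of positive rational probabilities summing to $1$; $I_n(F)$ denotes a list of $n$ items whose sizes are drawn i.i.d. according to $F$. For an algorithm $A$, $\mathrm{AECR}(A,F)=\liminf_{n\to\infty}\mathbb{E}[A(I_n(F))]/\mathbb{E}[\mathrm{OPT}(I_n(F))]$ and $\overline{\mathrm{AECR}}(A)=\inf_F \mathrm{AECR}(A,F)$, the infimum over all discrete distributions. *)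

(* Defs.v *)
From mathcomp Require Import all_boot all_order all_algebra.
From mathcomp Require Import all_classical all_reals all_analysis.

Set Implicit Arguments.
Unset Strict Implicit.
Unset Printing Implicit Defensive.

Import Order.TTheory GRing.Theory Num.Theory.
Local Open Scope classical_set_scope.
Local Open Scope ring_scope.

(* Items are identified with their positions in L, so that equal sizes at
   different positions are different items.  A family of pairwise disjoint bins
   is a set of bins: covered bins are nonempty, so no bin can be repeated. *)
Definition opt (R : realType) (L : seq R) : nat :=
  \max_(P : {set {set 'I_(size L)}} |
        finset.trivIset P && [forall B in P, 1 <= \sum_(i in B) L`_i]) #|P|.

(* c is the total size in the current bin *)
Fixpoint dnf_from (R : realType) (c : R) (L : seq R) : nat :=
  if L is a :: L' then
    if 1 <= c + a then (dnf_from 0 L').+1 else dnf_from (c + a) L'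
  else 0%N.

Definition dnf (R : realType) (L : seq R) : nat := dnf_from 0 L.

Record discrete_distribution := DiscreteDistribution {
  nb_sizes : nat;
  item_size : 'I_nb_sizes -> rat;
  item_prob : 'I_nb_sizes -> rat;
  item_size_itv : forall i, 0 <= item_size i <= 1;
  item_prob_gt0 : forall i, 0 < item_prob i;
  item_prob_sum1 : \sum_i item_prob i = 1 }.

(* E[A(I_n(F))]: the list I_n(F) is the image of a word w of n size indices,
   and independence gives w the probability \prod_k item_prob (w_k). *)
Definition expected_value (R : realType) (A : seq R -> nat)
    (F : discrete_distribution) (n : nat) : R :=
  \sum_(w : n.-tuple 'I_(nb_sizes F))
    (\prod_(k < n) ratr (item_prob (tnth w k))) *
    (A [seq ratr (item_size i) | i <- w])%:R.

Definition AECR (R : realType) (A : seq R -> nat)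
    (F : discrete_distribution) : \bar R :=
  limn_einf (fun n => (expected_value A F n / expected_value (@opt R) F n)%:E).

(* If all sizes of F are 0, then E[OPT(I_n(F))] = 0 for all n and AECR(A, F) is
   the undefined 0/0 (which the library would evaluate to 0); such F are left
   out of the infimum.  If some size is positive, E[OPT(I_n(F))] > 0 for all
   large n, and the finitely many other n do not affect the limit inferior. *)
Definition worst_AECR (R : realType) (A : seq R -> nat) : \bar R :=
  ereal_inf [set AECR A F | F in [set F | exists i, 0 < @item_size F i]].

(* Main.v *)
(* Both sides are bounded by finite certificates.  If every covered bin has
   total weight at least 1 under a weight w, then E[OPT(I_n(F))] <= n E[w(X)];
   if the potential V of the level of the current bin satisfies
   V(c) + lam <= E[1 + V(0) if c + X >= 1, V(c + X) otherwise], then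
   E[DNF(I_n(F))] >= n lam - O(1).  The potential V(c) = c / 2 and the weight
   w(a) = a only give the ratio 1/2, and they are nearly tight only if bins are
   mostly closed by an item near 1 at a level near 1.  Call an item big if its
   size is at least 3/4, let b be the probability of a big item, and let 1 - t
   be an upper quantile of the big sizes.
   - If the other items have a mean size of at least b / 2, they close a
     positive fraction of the bins, and these have overshoot at most 3/4.
   - Otherwise, if the other items seldom add up to t before the next big item
     comes, then most big items have to be paired, OPT is little more than half
     the number of big items, and a weight vanishing at 0 with slope 1 / (2 t)
     certifies this.
   - Otherwise, with constant probability a bin starts with a big item of size
     at least 1 - t and is then closed by small items, with little overshoot.
   In the first and the third case the saving is made precise by adding to c / 2
   a small bonus that grows exponentially on the levels [1 - t, 1) (t = 1 in
   the first case). *)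
Require Import Defs.
From mathcomp Require Import all_boot all_order all_algebra.
From mathcomp Require Import all_classical all_reals all_analysis.
From mathcomp Require Import ring lra.
Set Implicit Arguments.
Unset Strict Implicit.
Unset Printing Implicit Defensive.

Import Order.TTheory GRing.Theory Num.Theory.
Local Open Scope ring_scope.

(** * Expectations over i.i.d. words *)

(** [g] takes sequences rather than tuples, so that inductions on [n] can peel off the first letter
    without casts. *)
Definition word_mean (R : realType) (T : finType) (p : T -> R) (n : nat)
    (g : seq T -> R) : R :=
  \sum_(w : n.-tuple T) (\prod_(k < n) p (tnth w k)) * g w.

Lemma word_mean0 (R : realType) (T : finType) (p : T -> R) (g : seq T -> R) :
  word_mean p 0 g = g [::].
Proof.
rewrite /word_mean (eq_bigr (fun=> g [::])) => [|w _].
  by rewrite sumr_const card_tuple expn0.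
by rewrite big_ord0 mul1r tuple0.
Qed.

Lemma word_meanS (R : realType) (T : finType) (p : T -> R) (n : nat)
    (g : seq T -> R) :
  word_mean p n.+1 g = \sum_i p i * word_mean p n (fun w => g (i :: w)).
Proof.
rewrite /word_mean.
under [RHS]eq_bigr do rewrite mulr_sumr.
rewrite pair_big /= (reindex (fun q : T * n.-tuple T => cons_tuple q.1 q.2)) /=.
  apply: eq_bigr => -[i w] _ /=.
  rewrite big_ord_recl mulrA; congr (_ * _ * _).
  by apply: eq_bigr => k _; rewrite tnthS.
exists (fun w => (thead w, behead_tuple w)) => [[i w] _|w _] /=.
  by congr pair; apply: val_inj.
by rewrite [RHS]tuple_eta; apply: val_inj.
Qed.

Lemma ler_word_mean (R : realType) (T : finType) (p : T -> R) (n : nat)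
    (g h : seq T -> R) :
  (forall i, 0 <= p i) -> (forall w, g w <= h w) ->
  word_mean p n g <= word_mean p n h.
Proof.
by move=> p0 gh; apply: ler_sum => w _; rewrite ler_wpM2l ?prodr_ge0.
Qed.

Lemma word_meanDl (R : realType) (T : finType) (p : T -> R) (n : nat)
    (g : seq T -> R) (x : R) : \sum_i p i = 1 ->
  word_mean p n (fun w => x + g w) = x + word_mean p n g.
Proof.
move=> p1; elim: n g => [|n IHn] g; first by rewrite !word_mean0.
rewrite !word_meanS.
under eq_bigr do rewrite IHn mulrDr.
by rewrite big_split /= -mulr_suml p1 mul1r.
Qed.

Lemma word_mean_sum (R : realType) (T : finType) (p f : T -> R) (n : nat) :
  \sum_i p i = 1 ->
  word_mean p n (fun w => \sum_(i <- w) f i) = n%:R * \sum_i p i * f i.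
Proof.
move=> p1; elim: n => [|n IHn]; first by rewrite word_mean0 big_nil mul0r.
rewrite word_meanS.
under eq_bigr => i _.
  rewrite (_ : (fun w => _) = (fun w => f i + \sum_(j <- w) f j)); last first.
    by apply/funext => w; rewrite big_cons.
  rewrite word_meanDl // IHn mulrDr; over.
by rewrite big_split /= -mulr_suml p1 mul1r -[n.+1]addn1 natrD mulrDl mul1r addrC.
Qed.

(** * DNF and potentials *)

(** Condition on the first item: the covered bins plus the potential of the level grow on average by
    at least [lam] per item, and [B] pays for the potential left at the end. *)
Lemma dnf_drift (R : realType) (T : finType) (p s : T -> R) (V : R -> R)
    (lam B c : R) (n : nat) :
  (forall i, 0 <= p i) -> \sum_i p i = 1 -> (forall i, 0 <= s i) ->
  (forall x, 0 <= x < 1 -> V x <= B) ->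
  (forall x, 0 <= x < 1 -> V x + lam <=
     \sum_i p i * (if 1 <= x + s i then 1 + V 0 else V (x + s i))) ->
  0 <= c < 1 ->
  n%:R * lam + V c - B <= word_mean p n (fun w => (dnf_from c (map s w))%:R).
Proof.
move=> p0 p1 s0 VB drift; elim: n c => [|n IHn] c c01.
  by rewrite word_mean0 mul0r add0r subr_le0 VB.
rewrite word_meanS.
have {drift} := drift c c01.
rewrite -(lerD2l (n%:R * lam - B)) => drift.
rewrite [X in X <= _](_ : _ = n%:R * lam - B + (V c + lam)); last first.
  by rewrite -[n.+1]addn1 natrD; ring.
apply: (le_trans drift).
have -> x : x + \sum_i p i * (if 1 <= c + s i then 1 + V 0 else V (c + s i)) =
    \sum_i p i * (x + (if 1 <= c + s i then 1 + V 0 else V (c + s i))).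
  under [RHS]eq_bigr do rewrite mulrDr.
  by rewrite big_split /= -mulr_suml p1 mul1r.
apply: ler_sum => i _; rewrite ler_wpM2l //.
case: (leP 1 (c + s i)) => ci.
  rewrite (_ : (fun w => _) =
      (fun w => 1 + (dnf_from 0 (map s w))%:R)); last first.
    by apply/funext => w /=; rewrite ci -natr1 addrC.
  rewrite word_meanDl //.
  by have := IHn 0; rewrite lexx ltr01 => /(_ isT); lra.
rewrite (_ : (fun w => _) =
    (fun w => (dnf_from (c + s i) (map s w))%:R)); last first.
  by apply/funext => w /=; rewrite leNgt ci.
have := IHn (c + s i); rewrite ci addr_ge0 //; last by case/andP: c01.
by move=> /(_ isT); lra.
Qed.

(** * OPT: positivity and weight bounds *)

(** Combined with [opt_gt0], this makes OPT positive wherever DNF is, which keeps the denominator of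
    the final ratio positive. *)
Lemma dnf_from_gt0 (R : realType) (c : R) (L : seq R) :
  (forall a, a \in L -> 0 <= a) ->
  (0 < dnf_from c L)%N -> 1 <= c + \sum_(a <- L) a.
Proof.
elim: L c => //= a L IHL c L0.
have L0' x : x \in L -> 0 <= x by move=> xL; rewrite L0 ?inE ?xL ?orbT.
rewrite big_cons addrA; case: ifPn => [ca _|_]; last exact: IHL.
rewrite (le_trans ca) // lerDl big_seq sumr_ge0 //.
Qed.

Lemma opt_gt0 (R : realType) (L : seq R) :
  1 <= \sum_(a <- L) a -> (0 < opt L)%N.
Proof.
move=> L1; rewrite /opt.
pose P := [set [set: 'I_(size L)]]%SET.
apply: (bigop.bigmax_sup P); rewrite /P ?cards1 //.
rewrite finset.trivIset1 /=; apply/forallP => B; apply/implyP; rewrite inE => /eqP->.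
rewrite (_ : \sum_(i in _) _ = \sum_(a <- L) a) //.
rewrite (big_nth 0) big_mkord; apply: eq_bigl => i; by rewrite inE.
Qed.

(** Indexing by an arbitrary finite type allows items of equal size; [opt_le_weight] uses the
    positions of the list. *)
Definition covering_weight (R : realType) (w : R -> R) :=
  forall (T : finType) (A : {set T}) (f : T -> R),
    (forall i, 0 <= f i <= 1) -> 1 <= \sum_(i in A) f i ->
    1 <= \sum_(i in A) w (f i).

Lemma opt_le_weight (R : realType) (w : R -> R) (L : seq R) :
  covering_weight w -> (forall a, 0 <= a <= 1 -> 0 <= w a) ->
  (forall a, a \in L -> 0 <= a <= 1) ->
  (opt L)%:R <= \sum_(a <- L) w a.
Proof.
move=> cw w0 L01; rewrite /opt.
have Li (i : 'I_(size L)) : 0 <= L`_i <= 1 by rewrite L01 ?mem_nth.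
elim/big_ind: _ => [|m n mL nL|P /andP[tP /forallP cP]].
- by rewrite big_seq sumr_ge0 // => a /L01/w0.
- by rewrite /maxn; case: ifP.
rewrite [leRHS](big_nth 0) big_mkord.
apply: (@le_trans _ _ (\sum_(i in finset.cover P) w L`_i)).
  rewrite finset.big_trivIset //= -sumr_const; apply: ler_sum => B BP.
  apply: (cw _ B (fun i : 'I_(size L) => L`_i)) => //.
  by have /implyP := cP B; apply.
rewrite [leRHS](bigID (mem (finset.cover P))) /= lerDl sumr_ge0 // => i _.
exact: w0.
Qed.

(* A bin without items larger than 1 - t has total weight at least 1: one item
   of size in [t, 1 - t] leaves a gap of at least t for the others. *)
Definition gap_weight (R : realType) (t a : R) : R :=
  if 1 - t < a then 1 else Num.min t a / (2 * t).

Lemma min_sum_le (R : realType) (T : finType) (P : pred T) (f : T -> R) (t : R) :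
  0 <= t -> (forall i, 0 <= f i) ->
  Num.min t (\sum_(i | P i) f i) <= \sum_(i | P i) Num.min t (f i).
Proof.
move=> t0 f0.
(* Nonnegativity is carried along because [Num.min t] is not subadditive once negative arguments are
   allowed. *)
suff : 0 <= \sum_(i | P i) f i /\
    Num.min t (\sum_(i | P i) f i) <= \sum_(i | P i) Num.min t (f i) by case.
elim/big_ind2: _ => [|x1 x2 y1 y2 [x10 hx] [y10 hy]|i _].
- by rewrite lexx minElt; case: ltP => h; split => //; lra.
- split; first exact: addr_ge0.
  apply: le_trans (lerD hx hy).
  by rewrite !minElt; do 3 case: ltP => ?; lra.
- by [].
Qed.

Lemma covering_gap_weight (R : realType) (t : R) :
  0 < t <= 1 / 4 -> covering_weight (gap_weight t).
Proof.
move=> /andP[t0 t4] T A f f01 fA.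
have f0 i : 0 <= f i by case/andP: (f01 i).
have w0 i : 0 <= gap_weight t (f i).
  rewrite /gap_weight; case: ifP => // _.
  by rewrite divr_ge0 ?mulr_ge0 ?le_min ?f0 ?ltW.
have [[i iA fi]|nobig] := pselect (exists2 i, i \in A & 1 - t < f i).
  by rewrite (bigD1 i) //= {1}/gap_weight fi lerDl sumr_ge0.
have -> : \sum_(i in A) gap_weight t (f i) =
    (\sum_(i in A) Num.min t (f i)) / (2 * t).
  rewrite mulr_suml; apply: eq_bigr => i iA; rewrite /gap_weight.
  by case: ifP => // fi; case: nobig; exists i.
rewrite ler_pdivlMr ?mulr_gt0 // mul1r.
have [[i iA fi]|nomid] := pselect (exists2 i, i \in A & t <= f i).
  have fi1 : f i <= 1 - t.
    by rewrite leNgt; apply/negP => h; apply: nobig; exists i.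
  rewrite (bigD1 i) //= (min_idPl fi).
  have := @min_sum_le R T (fun j => (j \in A) && (j != i)) f t (ltW t0) f0.
  move: fA; rewrite (bigD1 i) //= => fA.
  by rewrite (min_idPl _); lra.
(* Only sizes below [t] remain: truncation changes nothing, and the total is at least 1, hence at
   least [2 * t]. *)
rewrite (eq_bigr f) ?(le_trans _ fA) //; first lra.
move=> i iA; apply/min_idPr; rewrite leNgt; apply/negP => h.
by apply: nomid; exists i => //; exact: ltW.
Qed.

(** * One-item means and quantiles *)

(* Expectation of f(X), where X has the value s i with probability p i. *)
Definition mean (R : realType) (T : finType) (p s : T -> R) (f : R -> R) : R :=
  \sum_i p i * f (s i).

Lemma ler_mean (R : realType) (T : finType) (p s : T -> R) (f g : R -> R) :
  (forall i, 0 <= p i) -> (forall i, 0 <= s i <= 1) ->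
  (forall a, 0 <= a <= 1 -> f a <= g a) -> mean p s f <= mean p s g.
Proof. by move=> p0 s01 fg; apply: ler_sum => i _; rewrite ler_wpM2l ?fg. Qed.

Lemma mean_linear (R : realType) (T : finType) (p s : T -> R) (f g h : R -> R)
    (w x y z : R) : \sum_i p i = 1 ->
  mean p s (fun a => w + x * f a + y * g a + z * h a) =
  w + x * mean p s f + y * mean p s g + z * mean p s h.
Proof.
move=> p1; rewrite -[w in RHS]mulr1 -p1 /mean !mulr_sumr -!big_split /=.
by apply: eq_bigr => i _; ring.
Qed.

(** The threshold climbs through the finitely many sizes until its strict tail falls below [q]; the
    induction is on the number of indices of larger size. *)
Lemma tail_quantile (R : realType) (T : finType) (p s : T -> R) (q x : R) :
  0 < q -> q <= mean p s (fun a => (x <= a)%R%:R) ->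
  exists y, [/\ x <= y, q <= mean p s (fun a => (y <= a)%R%:R) &
    mean p s (fun a => (y < a)%R%:R) < q].
Proof.
move=> q0; move: {2}#|_|.+1 (ltnSn #|[set j | x < s j]%SET|) => n.
elim: n x => // n IHn x; rewrite ltnS => cx qx.
have [hlt|hge] := ltP (mean p s (fun a => (x < a)%R%:R)) q; first by exists x.
have /existsP[j0 xj0] : [exists j, x < s j].
  apply: contraLR hge => /existsPn nx; rewrite -ltNge /mean big1 // => j _.
  by rewrite (negPf (nx j)) mulr0.
have [j xj jmin] := @arg_minP _ R T j0 (fun j => x < s j) s xj0.
have [||y [jy qy yq]] := IHn (s j).
- apply: leq_trans cx; apply: proper_card; apply/properP; split.
    by apply/fintype.subsetP => k; rewrite !inE; apply: lt_trans.
  by exists j; rewrite !inE // ltxx.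
- rewrite (le_trans hge) //; apply: ler_sum => k _.
  have [xk|] := ltP x (s k); first by rewrite jmin.
  by move=> kx; rewrite [s j <= s k]leNgt (le_lt_trans kx xj).
by exists y; split => //; rewrite (le_trans (ltW xj)).
Qed.

(** * The potential and its pointwise gains *)

(* The rate 10 makes the expected growth of the exponential by small items exceed
   its loss when a big item closes the bin.  The linear part on the lower levels
   rewards leaving [3/4, 1 - t) and is dominated, at the levels below 3/4, by
   the jump of at least 10 at 1 - t. *)
Definition bonus (R : realType) (t c : R) : R :=
  if c < 1 - t then - c else 10 * expR (10 * ((c - (1 - t)) / t)).

Definition potential (R : realType) (e t c : R) : R := c / 2 + e * bonus t c.

Definition next_value (R : realType) (V : R -> R) (c a : R) : R :=
  if 1 <= c + a then 1 + V 0 else V (c + a).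

Lemma bonus_ge (R : realType) (t c : R) : 0 <= c -> - c <= bonus t c.
Proof.
move=> c0; rewrite /bonus; case: ifP => // _.
by rewrite (@le_trans _ _ 0) ?oppr_le0 // mulr_ge0 ?expR_ge0.
Qed.

Lemma bonus_ge10 (R : realType) (t c : R) :
  0 <= t -> 1 - t <= c -> 10 <= bonus t c.
Proof.
move=> t0 tc; rewrite /bonus ltNge tc /= ler_peMr //.
by rewrite -[leLHS]expR0 ler_expR mulr_ge0 // divr_ge0 // subr_ge0.
Qed.

Lemma bonus_le (R : realType) (t c : R) :
  0 <= t -> 0 <= c < 1 -> bonus t c <= 10 * expR 10.
Proof.
move=> t0 /andP[c0 c1]; rewrite /bonus; case: ltP => [_|tc].
  by rewrite (@le_trans _ _ 0) ?oppr_le0 // mulr_ge0 ?expR_ge0.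
rewrite ler_wpM2l // ler_expR ler_piMr //.
have t0' : 0 < t by lra.
by rewrite ler_pdivrMr // mul1r; lra.
Qed.

Lemma bonus_growth (R : realType) (t c a : R) :
  0 < t -> 0 <= a -> 1 - t <= c ->
  bonus t c * (1 + 10 * (a / t)) <= bonus t (c + a).
Proof.
move=> t0 a0 tc; have tca : 1 - t <= c + a by lra.
rewrite /bonus !ltNge tc tca /= -mulrA ler_wpM2l //.
rewrite (_ : 10 * ((c + a - _) / t) =
  10 * ((c - (1 - t)) / t) + 10 * (a / t)); last by field; lra.
by rewrite expRD ler_wpM2l ?expR_ge0 // expR_ge1Dx.
Qed.

(** A small item multiplies the bonus by at least [1 + 10 * (a / t)] or closes the bin with slack; a
    big item costs at most the whole bonus. *)
Lemma gain_high (R : realType) (e t c a : R) :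
  0 <= e -> 880 * expR 10 * e <= 1 -> 0 < t <= 1 ->
  1 - t <= c -> 0 <= c < 1 -> 0 <= a <= 1 ->
  potential e t c + 1 / 2 * a +
    10 * (e * bonus t c) * ((a < 3 / 4)%R%:R * Num.min 1 (a / t)) +
    - (e * bonus t c) * (3 / 4 <= a)%R%:R
  <= next_value (potential e t) c a.
Proof.
move=> e0 eE /andP[t0 t1] tc c01 /andP[a0 a1].
have y10 := bonus_ge10 (ltW t0) tc.
have yE := bonus_le (ltW t0) c01.
have /andP[c0 c1] := c01.
(* Closing by a small item leaves slack [1 - (1 + 3 / 4) / 2 = 1 / 8 = 11 / 88], which pays for the
   lost bonus and a gain of ten times as much. *)
have ey : e * bonus t c <= 1 / 88.
  rewrite (@le_trans _ _ (e * (10 * expR 10))) ?ler_wpM2l //; lra.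
have ey0 : 0 <= e * bonus t c by rewrite mulr_ge0 // (le_trans _ y10).
have m0 : 0 <= Num.min 1 (a / t) by rewrite le_min ler01 divr_ge0 // ltW.
have m1 : Num.min 1 (a / t) <= 1 by rewrite ge_min lexx.
rewrite /next_value /potential.
case: (leP 1 (c + a)) => [ca|ca].
  have h := bonus_ge t (lexx 0).
  have eb0 : 0 <= e * bonus t 0 by rewrite mulr_ge0 //; move: h; rewrite oppr0.
  have em : e * bonus t c * Num.min 1 (a / t) <= e * bonus t c.
    by rewrite ler_piMr.
  by case: (leP (3 / 4) a) => a34 /=; lra.
have grow := bonus_growth t0 a0 tc.
have at0 : 0 <= a / t by rewrite divr_ge0 // ltW.
have mE : Num.min 1 (a / t) = a / t.
  by apply/min_idPr; rewrite ler_pdivrMr // mul1r; lra.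
have /(ler_wpM2l e0) egrow := grow.
case: (leP (3 / 4) a) => a34 /=; last by rewrite mE; nra.
have : 0 <= e * bonus t c * (10 * (a / t)) by rewrite mulr_ge0 // mulr_ge0.
lra.
Qed.

(** An item of size at least [1 - t] lifts the level to where the bonus is at least 10, or closes
    the bin with slack at least [1 - (3 / 4 + 1) / 2 = 1 / 8], whence [e <= 1 / 80]. *)
Lemma gain_low (R : realType) (e t c a : R) :
  0 <= e <= 1 / 80 -> 0 <= t <= 1 / 4 ->
  0 <= c < 1 - t -> c < 3 / 4 -> 0 <= a <= 1 ->
  potential e t c + 1 / 2 * a +
    11 * e * (1 - t <= a)%R%:R +
    - e * ((3 / 4 <= a)%R%:R + (a < 3 / 4)%R%:R * a)
  <= next_value (potential e t) c a.
Proof.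
move=> /andP[e0 e80] /andP[t0 t4] /andP[c0 ct] c34 /andP[a0 a1].
rewrite /next_value /potential {1}/bonus ct.
have ec0 : 0 <= e * c by rewrite mulr_ge0.
have ea0 : 0 <= e * a by rewrite mulr_ge0.
case: (leP 1 (c + a)) => [ca|ca].
  rewrite /bonus ifT; last lra.
  by case: (leP (3 / 4) a) => a34 /=; case: (leP (1 - t) a) => ta /=; lra.
have /(ler_wpM2l e0) h := bonus_ge t (addr_ge0 c0 a0).
have ea1 : e * a <= e by rewrite ler_piMr.
case: (leP (1 - t) a) => ta /=; last first.
  by case: (leP (3 / 4) a) => a34 /=; lra.
have /(ler_wpM2l e0) h10 : 10 <= bonus t (c + a) by apply: bonus_ge10; lra.
by case: (leP (3 / 4) a) => a34 /=; lra.
Qed.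

(** Here a big item always closes the bin, and the bonus rises from [- c] to 0, its value at the
    empty level. *)
Lemma gain_middle (R : realType) (e t c a : R) :
  0 <= e <= 1 / 80 -> 0 <= t <= 1 / 4 ->
  3 / 4 <= c < 1 - t -> 0 <= a <= 1 ->
  potential e t c + 1 / 2 * a +
    3 / 4 * e * (3 / 4 <= a)%R%:R +
    - e * ((a < 3 / 4)%R%:R * a)
  <= next_value (potential e t) c a.
Proof.
move=> /andP[e0 e80] /andP[t0 t4] /andP[c0 ct] /andP[a0 a1].
rewrite /next_value /potential {1}/bonus ct.
have ec34 : e * (3 / 4) <= e * c by rewrite ler_wpM2l.
have ea0 : 0 <= e * a by rewrite mulr_ge0.
case: (leP 1 (c + a)) => [ca|ca].
  rewrite /bonus ifT; last lra.
  by case: (leP (3 / 4) a) => a34 /=; lra.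
have ca0 : 0 <= c + a by lra.
have /(ler_wpM2l e0) h := bonus_ge t ca0.
have -> : (3 / 4 <= a) = false by apply/negP; lra.
by case: (ltP a (3 / 4)) => a34 /=; lra.
Qed.

Lemma potential_le1 (R : realType) (e t c : R) :
  0 <= e -> 880 * expR 10 * e <= 1 -> 0 <= t -> 0 <= c < 1 ->
  potential e t c <= 1.
Proof.
move=> e0 eE t0 c01; have /(ler_wpM2l e0) := bonus_le t0 c01.
by case/andP: c01 => c0 c1; rewrite /potential; lra.
Qed.

Lemma gap_weight_le (R : realType) (t a : R) : 0 < t <= 1 / 4 -> 0 <= a ->
  gap_weight t a <= 0 + 1 / 2 * (3 / 4 <= a)%R%:R + 1 / 2 * (1 - t < a)%R%:R +
    1 / 2 * ((a < 3 / 4)%R%:R * Num.min 1 (a / t)).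
Proof.
move=> /andP[t0 t4] a0; rewrite /gap_weight.
have at0 : 0 <= a / t by rewrite divr_ge0 // ltW.
have -> : Num.min t a / (2 * t) = 1 / 2 * Num.min 1 (a / t).
  have -> : Num.min t a = t * Num.min 1 (a / t).
    by rewrite minr_pMr ?ltW // mulr1 mulrCA mulfV ?mulr1 ?gt_eqF.
  by field; lra.
have m1 : Num.min 1 (a / t) <= 1 by rewrite ge_min lexx.
by case: (leP (3 / 4) a) => a34; case: ltP => ta /=; lra.
Qed.

Lemma gap_weight_ge0 (R : realType) (t a : R) : 0 < t -> 0 <= a ->
  0 <= gap_weight t a.
Proof.
move=> t0 a0; rewrite /gap_weight; case: ifP => // _.
by rewrite divr_ge0 ?mulr_ge0 ?le_min ?a0 ?ltW.
Qed.

(** * Expected drift and choice of the certificate *)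

Definition big_rate (R : realType) (T : finType) (p s : T -> R) : R :=
  mean p s (fun a => (3 / 4 <= a)%R%:R).

Definition small_mass (R : realType) (T : finType) (p s : T -> R) : R :=
  mean p s (fun a => (a < 3 / 4)%R%:R * a).

Definition small_rate (R : realType) (T : finType) (p s : T -> R) (t : R) : R :=
  mean p s (fun a => (a < 3 / 4)%R%:R * Num.min 1 (a / t)).

(** The bonus is at least 10 at these levels, so the extra drift is at least [10 * e / 60] times the
    mean size, which is the required [e / 6]. *)
Lemma drift_high (R : realType) (T : finType) (p s : T -> R) (e t c : R) :
  (forall i, 0 <= p i) -> \sum_i p i = 1 -> (forall i, 0 <= s i <= 1) ->
  0 <= e -> 880 * expR 10 * e <= 1 -> 0 < t <= 1 ->
  0 <= mean p s id <= 60 * (10 * small_rate p s t - big_rate p s) ->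
  1 - t <= c -> 0 <= c < 1 ->
  potential e t c + (1 / 2 + e / 6) * mean p s id <=
    mean p s (next_value (potential e t) c).
Proof.
move=> p0 p1 s01 e0 eE t01 /andP[mu0 muN] tc c01.
have := ler_mean p0 s01 (fun a => gain_high e0 eE t01 tc c01 (a := a)).
rewrite mean_linear // -/(big_rate p s) -/(small_rate p s t).
apply: le_trans.
have y10 : 10 <= bonus t c by apply: bonus_ge10 => //; case/andP: t01 => /ltW.
set N := 10 * small_rate p s t - big_rate p s in muN.
have N0 : 0 <= N by lra.
have h1 : 10 * N <= bonus t c * N by rewrite ler_wpM2r.
have h2 : 6^-1 * mean p s id <= bonus t c * N by lra.
have := ler_wpM2l e0 h2; rewrite /N; lra.
Qed.

(** With b the big rate, the mean is at most [3 / 2 * b], so an extra drift of [e * b / 4] suffices.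
    Below level 3/4 there is at least [(11 / 5 - 1 - 1 / 2) * e * b]; above it,
    [(3 / 4 - 1 / 2) * e * b], which dictates [e / 6]. *)
Lemma drift_low (R : realType) (T : finType) (p s : T -> R) (e t c : R) :
  (forall i, 0 <= p i) -> \sum_i p i = 1 -> (forall i, 0 <= s i <= 1) ->
  0 <= big_rate p s -> 0 <= e <= 1 / 80 -> 0 <= t <= 1 / 4 ->
  big_rate p s / 5 <= mean p s (fun a => (1 - t <= a)%R%:R) ->
  small_mass p s <= big_rate p s / 2 ->
  mean p s id <= big_rate p s + small_mass p s ->
  0 <= c < 1 - t ->
  potential e t c + (1 / 2 + e / 6) * mean p s id <=
    mean p s (next_value (potential e t) c).
Proof.
move=> p0 p1 s01 b0 e01 t04 bt sb mub ct.
have /andP[e0 _] := e01.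
have eb0 := mulr_ge0 e0 b0.
have := ler_wpM2l e0 bt; have := ler_wpM2l e0 sb; have := ler_wpM2l e0 mub.
have [c34|c34] := ltP c (3 / 4).
  have := ler_mean p0 s01 (fun a => gain_low e01 t04 ct c34 (a := a)).
  have -> : (fun a => potential e t c + 1 / 2 * a + 11 * e * (1 - t <= a)%R%:R +
      - e * ((3 / 4 <= a)%R%:R + (a < 3 / 4)%R%:R * a)) =
    (fun a => potential e t c + 1 * (1 / 2 * a - e * (3 / 4 <= a)%R%:R) +
      11 * e * (1 - t <= a)%R%:R + - e * ((a < 3 / 4)%R%:R * a)).
    by apply/funext => a; ring.
  rewrite mean_linear // -/(small_mass p s).
  have -> : (fun a => 1 / 2 * a - e * (3 / 4 <= a)%R%:R) =
    (fun a => 0 + 1 / 2 * a + (- e) * (3 / 4 <= a)%R%:R + 0 * a).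
    by apply/funext => a; ring.
  rewrite mean_linear // -/(big_rate p s) => h h1 h2 h3.
  by apply: le_trans h; lra.
have /andP[_ ct'] := ct; have c34t : 3 / 4 <= c < 1 - t by rewrite c34.
have := ler_mean p0 s01 (fun a => gain_middle e01 t04 c34t (a := a)).
rewrite mean_linear // -/(small_mass p s) -/(big_rate p s) => h h1 h2 h3.
by apply: le_trans h; lra.
Qed.

Lemma rate_certificate (R : realType) (T : finType) (p s : T -> R) (e : R) :
  (forall i, 0 <= p i) -> \sum_i p i = 1 -> (forall i, 0 <= s i <= 1) ->
  0 < mean p s id -> 0 <= e -> 880 * expR 10 * e <= 1 ->
  exists w V : R -> R,
    [/\ covering_weight w, forall a, 0 <= a <= 1 -> 0 <= w a, 0 < mean p s w,
        forall c, 0 <= c < 1 -> V c <= 1 &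
        forall c, 0 <= c < 1 ->
          V c + (1 / 2 + e / 6) * mean p s w <= mean p s (next_value V c)].
Proof.
move=> p0 p1 s01 mu0 e0 eE.
have e80 : 0 <= e <= 1 / 80.
  rewrite e0 /=; have : 1 <= expR 10 :> R by rewrite -[leLHS]expR0 ler_expR.
  by move=> /(ler_wpM2r e0); lra.
have mean0 f : (forall a, 0 <= a <= 1 -> 0 <= f a) -> 0 <= mean p s f.
  by move=> f0; apply: sumr_ge0 => i _; rewrite mulr_ge0 ?f0.
have b0 : 0 <= big_rate p s by apply: mean0 => a _.
have mub : mean p s id <= big_rate p s + small_mass p s.
  have -> : big_rate p s + small_mass p s = mean p s (fun a =>
      0 + 1 * (3 / 4 <= a)%R%:R + 1 * ((a < 3 / 4)%R%:R * a) + 0 * a).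
    by rewrite mean_linear // -/(small_mass p s) -/(big_rate p s); ring.
  by apply: ler_mean => // a /andP[a0 a1]; case: (leP (3 / 4) a) => ? /=; lra.
have bmu : 3 / 4 * big_rate p s <= mean p s id.
  have -> : 3 / 4 * big_rate p s = mean p s (fun a =>
      0 + 3 / 4 * (3 / 4 <= a)%R%:R + 0 * a + 0 * a).
    by rewrite mean_linear // -/(big_rate p s); ring.
  by apply: ler_mean => // a /andP[a0 a1]; case: (leP (3 / 4) a) => ? /=; lra.
have with_potential t : 0 <= t <= 1 ->
    (forall c, 0 <= c < 1 -> potential e t c + (1 / 2 + e / 6) * mean p s id <=
       mean p s (next_value (potential e t) c)) ->
    exists w V : R -> R,
    [/\ covering_weight w, forall a, 0 <= a <= 1 -> 0 <= w a, 0 < mean p s w,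
        forall c, 0 <= c < 1 -> V c <= 1 &
        forall c, 0 <= c < 1 ->
          V c + (1 / 2 + e / 6) * mean p s w <= mean p s (next_value V c)].
  move=> /andP[t0 t1] drift; exists id, (potential e t); split => //.
  - by move=> a /andP[].
  - by move=> c c01; apply: potential_le1.
have [bnu|nub] := leP (big_rate p s / 2) (small_mass p s).
  (* With [t = 1] every level is at least [1 - t], so [drift_high] covers them all. *)
  apply: (with_potential 1); first by rewrite ler01 lexx.
  move=> c c01; apply: drift_high => //; first by rewrite ltr01 lexx.
    have : small_mass p s <= small_rate p s 1.
      apply: ler_mean => // a /andP[a0 a1].
      by rewrite divr1 (min_idPr a1).
    by move=> h; apply/andP; split; [exact: ltW | lra].
  by rewrite subrr; case/andP: c01.
have q0 : 0 < big_rate p s / 5 by lra.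
have qb : big_rate p s / 5 <= mean p s (fun a => (3 / 4 <= a)%R%:R).
  by rewrite -/(big_rate p s); lra.
have [y [y34 qy yq]] := tail_quantile q0 qb.
have y1 : y <= 1.
  rewrite leNgt; apply/negP => y1; suff : big_rate p s / 5 <= 0 by lra.
  apply: (le_trans qy); rewrite /mean big1 // => i _.
  have /andP[_ si1] := s01 i.
  by rewrite leNgt (le_lt_trans si1) ?mulr0.
have [t yt] : exists t, y = 1 - t by exists (1 - y); ring.
subst y; have t04 : 0 <= t <= 1 / 4 by apply/andP; lra.
have [/andP[t0 Nt]|Nt] := boolP ((0 < t) && (small_rate p s t < big_rate p s / 5)).
  have t04' : 0 < t <= 1 / 4 by rewrite t0; case/andP: t04.
  (* The strict tail beyond [1 - t] and the small rate are both below b / 5, and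
     [1 / 2 * (1 + 1 / 5 + 1 / 5) = 7 / 10]. *)
  have Kb : mean p s (gap_weight t) <= 7 / 10 * big_rate p s.
    have := @ler_mean _ _ p s (gap_weight t) _ p0 s01
      (fun a h => gap_weight_le t04' (proj1 (andP h))).
    by rewrite mean_linear // -/(big_rate p s) -/(small_rate p s t); lra.
  have bK : big_rate p s / 2 <= mean p s (gap_weight t).
    have -> : big_rate p s / 2 = mean p s (fun a =>
        0 + 1 / 2 * (3 / 4 <= a)%R%:R + 0 * a + 0 * a).
      by rewrite mean_linear // -/(big_rate p s); ring.
    apply: ler_mean => // a /andP[a0 a1].
    have [a34 /=|a34 /=] := leP (3 / 4) a; last first.
      by have := gap_weight_ge0 t0 a0; lra.
    rewrite /gap_weight; case: ifP => _; first lra.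
    have -> : Num.min t a = t by apply/min_idPl; case/andP: t04; lra.
    by rewrite invfM mulrCA mulfV ?gt_eqF //; lra.
  exists (gap_weight t), (fun c => c / 2); split.
  - exact: covering_gap_weight.
  - by move=> a /andP[a0 _]; apply: gap_weight_ge0.
  - lra.
  - by move=> c /andP[]; lra.
  move=> c c01.
  have : c / 2 + 1 / 2 * mean p s id <= mean p s (next_value (fun c => c / 2) c).
    have -> : c / 2 + 1 / 2 * mean p s id =
      mean p s (fun a => c / 2 + 1 / 2 * a + 0 * a + 0 * a).
      by rewrite mean_linear //; ring.
    apply: ler_mean => // a /andP[a0 a1]; case/andP: c01 => c0 c1.
    by rewrite /next_value; case: ifP => _; lra.
  apply: le_trans.
  (* The potential [c / 2] has drift at least [3 / 8 * b], which exceeds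
     [(1 / 2 + 1 / 480) * (7 / 10) * b]. *)
  have /andP[_ e80'] := e80.
  have : e * mean p s (gap_weight t) <= 1 / 80 * mean p s (gap_weight t).
    by rewrite ler_wpM2r //; lra.
  lra.
(* If [t = 0], all levels lie below [1 - t] and [drift_low] suffices; otherwise the small rate is at
   least b / 5. *)
apply: (with_potential t); first by case/andP: t04 => -> /=; lra.
move=> c c01; have [ct|tc] := ltP c (1 - t).
  by apply: drift_low => //; [exact: ltW | case/andP: c01 => ->].
have t0 : 0 < t by case/andP: c01; lra.
move: Nt; rewrite t0 -leNgt => Nt.
apply: drift_high => //; first by rewrite t0; case/andP: t04 => _; lra.
by apply/andP; split; [exact: ltW | lra].
Qed.

(** * Passage to the limit inferior *)

(** All words have positive probability, so a positive mean of [g] yields a word where [g], hence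
    [h], is positive. *)
Lemma word_mean_gt0 (R : realType) (T : finType) (p : T -> R) (n : nat)
    (g h : seq T -> R) :
  (forall i, 0 < p i) -> (forall w, 0 <= h w) -> (forall w, 0 < g w -> 0 < h w) ->
  0 < word_mean p n g -> 0 < word_mean p n h.
Proof.
move=> p0 h0 gh; rewrite !ltNge; apply: contra => hle.
have P0 (w : n.-tuple T) : 0 < \prod_(k < n) p (tnth w k) by exact: prodr_gt0.
have P0h (w : n.-tuple T) : 0 <= (\prod_(k < n) p (tnth w k)) * h w.
  by rewrite mulr_ge0 // ltW.
apply: sumr_le0 => w _; rewrite pmulr_rle0 // leNgt; apply/negP => /gh.
rewrite -(pmulr_rgt0 _ (P0 w)) ltNge => /negP; apply; apply: le_trans hle.
by rewrite /word_mean (bigD1 w) //= lerDl sumr_ge0.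
Qed.

Lemma expected_valueE (R : realType) (A : seq R -> nat)
    (F : discrete_distribution) (n : nat) :
  expected_value A F n =
  word_mean (fun i => ratr (@item_prob F i)) n
    (fun w => (A [seq ratr (@item_size F i) | i <- w])%:R).
Proof. by []. Qed.

Lemma limn_einf_ge (R : realType) (u : nat -> R) (l : R) (N : nat) :
  (forall n, (N <= n)%N -> l <= u n) -> (l%:E <= limn_einf (EFin \o u))%E.
Proof.
move=> lu; rewrite limn_einf_lim; apply: (@lime_ge _ _ _ _ _ _ _).
- exact: is_cvg_einfs.
- exists N => // n /= Nn; apply: le_ereal_inf_tmp => _ [k /= nk <-].
  by rewrite lee_fin lu // (leq_trans Nn).
Qed.

Lemma AECR_dnf_ge (R : realType) (F : discrete_distribution) (e : R) :
  (exists i, 0 < @item_size F i) -> 0 < e -> 880 * expR 10 * e <= 1 ->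
  ((2^-1 + e / 12)%:E <= AECR (@dnf R) F)%E.
Proof.
move=> [i0 si0] e0 eE.
pose p i : R := ratr (@item_prob F i); pose s i : R := ratr (@item_size F i).
have p_gt0 i : 0 < p i by rewrite ltr0q item_prob_gt0.
have p0 i : 0 <= p i by exact: ltW.
have p1 : \sum_i p i = 1 by rewrite -rmorph_sum /= item_prob_sum1 rmorph1.
have s01 i : 0 <= s i <= 1.
  by have := item_size_itv i; rewrite ler0q -(rmorph1 (ratr : rat -> R)) ler_rat.
have s0 i : 0 <= s i by case/andP: (s01 i).
have mu0 : 0 < mean p s id.
  have si0' : 0 < s i0 by rewrite ltr0q.
  rewrite /mean (bigD1 i0) //= ltr_pwDl ?(mulr_gt0 (p_gt0 i0)) //.
  by rewrite sumr_ge0 // => i _; rewrite mulr_ge0.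
have [w [V [cw w0 K0 V1 drift]]] :=
  rate_certificate p0 p1 s01 mu0 (ltW e0) eE.
set K := mean p s w in K0 drift.
have dnf_ge n : n%:R * ((1 / 2 + e / 6) * K) + (V 0 - 1) <=
    expected_value (@dnf R) F n.
  rewrite addrA expected_valueE.
  by apply: dnf_drift => //; rewrite lexx ltr01.
have opt_le n : expected_value (@opt R) F n <= n%:R * K.
  rewrite expected_valueE -(word_mean_sum (fun i => w (s i)) n p1).
  apply: ler_word_mean => // v; apply: (le_trans (opt_le_weight cw w0 _)).
    by move=> a /mapP[i _ ->]; exact: s01.
  by rewrite big_map.
(* Half of the surplus [e / 6] is given up to absorb the additive constant [V 0 - 1] for large
   [n]. *)
have [N HN] : exists N : nat, forall n, (N <= n)%N ->
    1 - V 0 <= n%:R * (e / 12 * K) /\ 0 < n%:R * ((1 / 2 + e / 6) * K) + (V 0 - 1).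
  pose x := `|1 - V 0| / (e / 12 * K).
  have eK : 0 < e / 12 * K by rewrite mulr_gt0 ?divr_gt0.
  have x0 : 0 <= x by rewrite divr_ge0 // ltW.
  exists (Num.bound x) => n bn.
  have : x < n%:R by rewrite (lt_le_trans (archi_boundP x0)) ?ler_nat.
  rewrite /x ltr_pdivrMr // => h.
  have := ler_norm (1 - V 0).
  have : 0 <= n%:R * (e / 12 * K) by rewrite mulr_ge0 // ltW.
  have : 0 <= n%:R * K by rewrite mulr_ge0 // ltW.
  by move=> *; split; lra.
apply: (@limn_einf_ge _ _ _ N) => n /HN [h1 h2].
have dnf0 : 0 < expected_value (@dnf R) F n by exact: lt_le_trans (dnf_ge n).
have opt0 : 0 < expected_value (@opt R) F n.
  move: dnf0; rewrite !expected_valueE; apply: word_mean_gt0 => // v.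
  rewrite !ltr0n => /dnf_from_gt0 h; apply: opt_gt0; rewrite -[leRHS]add0r.
  by apply: h => a /mapP[i _ ->]; exact: s0.
rewrite ler_pdivlMr //; apply: le_trans (dnf_ge n).
apply: (@le_trans _ _ ((2^-1 + e / 12) * (n%:R * K))); last by lra.
by rewrite ler_wpM2l // addr_ge0 // divr_ge0 // ltW.
Qed.

Unset Implicit Arguments.

Theorem theorem5 (R : realType) :
  exists eps : R, 0 < eps /\ ((2^-1 + eps)%:E <= worst_AECR (@dnf R))%E.
Proof.
have E0 : 0 < 880 * expR 10 :> R by have := expR_gt0 (10 : R); lra.
have [e [e0 eE]] : exists e : R, 0 < e /\ 880 * expR 10 * e <= 1.
  move: (880 * expR 10) E0 => k k0.
  by exists k^-1; rewrite invr_gt0 k0 mulfV ?lexx ?gt_eqF.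
exists (e / 12); split; first lra.
apply: le_ereal_inf_tmp => _ [F posF <-]; exact: AECR_dnf_ge.
Qed.
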